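(* Let $T_0=\operatorname{conv}\{e_1,e_2,-e_1-e_2\}\subset\mathbb R^3$ and let $Q\subset\mathbb R^3$ be a lattice polytope with $|Q|\geq 4$ and $L(T_0+Q)=2$. Then $|Q|=4$ and, after a lattice translation and a linear map in $\mathrm{GL}(3,\mathbb Z)$ mapping $T_0$ to itself, $Q$ equals either $\operatorname{conv}\{(0,0,0),(0,0,1),(3,0,-1)\}$ or $\operatorname{conv}\{(0,0,0),(1,0,0),(0,0,1),(1,2,-1)\}$. (The first is equivalent to $T_0$ and the second to $S_2=\operatorname{conv}\{e_1,e_2,e_3,e_1+e_2+e_3\}$.)
   Context: $|Q|$ is the number of lattice points of $Q$. The Minkowski length $L(P)$ is the largest $L$ such that $P$ contains a Minkowski sum of $L$ lattice polytopes each of positive dimension. Equivalence is via affine unimodular maps $x\mapsto Ux+b$, $U\in\mathrm{GL}(3,\mathbb Z)$, $b\in\mathbb Z^3$. *)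

(* Defs.v *)
From HB Require Import structures.
From mathcomp Require Import all_boot all_order all_algebra.
From mathcomp Require Import finmap.
From mathcomp Require Import boolp classical_sets cardinality reals.

Set Implicit Arguments.
Unset Strict Implicit.
Unset Printing Implicit Defensive.

Import Order.TTheory GRing.Theory Num.Theory.

Local Open Scope classical_set_scope.
Local Open Scope ring_scope.

Definition int_pt (R : realType) (n : nat) (z : 'cV[int]_n) : 'cV[R]_n :=
  map_mx intr z.

Definition conv (R : realType) (n : nat) (s : seq 'cV[R]_n) : set 'cV[R]_n :=
  [set x | exists a : 'I_(size s) -> R,
     [/\ forall i, 0 <= a i, \sum_i a i = 1 & x = \sum_i a i *: s`_i]].

Definition lattice_conv (R : realType) (n : nat) (s : seq 'cV[int]_n) :
    set 'cV[R]_n :=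
  conv [seq int_pt R z | z <- s].
Arguments lattice_conv R {n} s.

(* Polytopes are nonempty. *)
Definition lattice_polytope (R : realType) (n : nat) (P : set 'cV[R]_n) : Prop :=
  exists2 s : seq 'cV[int]_n, s != [::] & P = lattice_conv R s.

(* `fset_set` is empty on infinite sets; a lattice polytope is bounded, so that
   case does not occur for it. *)
Definition lattice_card (R : realType) (n : nat) (P : set 'cV[R]_n) : nat :=
  #|` fset_set [set z : 'cV[int]_n | P (int_pt R z)] |%fset.

Definition affine_dim (R : realType) (n : nat) (P : set 'cV[R]_n) : nat :=
  \max_(k < n.+1 | `[< exists (p : 'cV[R]_n) (D : 'M[R]_(n, k)),
      [/\ P p, forall j, P (p + col j D) & \rank D = k] >]) k.

Definition minkowski_add (R : realType) (n : nat) (A B : set 'cV[R]_n) :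
    set 'cV[R]_n :=
  [set x + y | x in A & y in B].

Definition minkowski_sum (R : realType) (n L : nat)
    (P : 'I_L -> set 'cV[R]_n) : set 'cV[R]_n :=
  \big[@minkowski_add R n/[set 0]]_(i < L) P i.

Definition contains_sum (R : realType) (n : nat) (P : set 'cV[R]_n) (L : nat) :
    Prop :=
  exists2 F : 'I_L -> set 'cV[R]_n,
    forall i, lattice_polytope (F i) /\ (0 < affine_dim (F i))%N &
    minkowski_sum F `<=` P.

(* The default value 0 gives the right answer when no sum with at least one
   summand fits in P (for L = 0, `contains_sum P 0` only says that P contains
   the origin). The maximum exists as soon as P is a lattice polytope of
   positive dimension. *)
Definition minkowski_length (R : realType) (n : nat) (P : set 'cV[R]_n) : nat :=
  xget 0%N [set L | contains_sum P L /\
                    forall M, contains_sum P M -> (M <= L)%N].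

(* Unimodular maps: integer matrices invertible over the integers. *)
Definition unimodular_image (R : realType) (n : nat) (U : 'M[int]_n)
    (P : set 'cV[R]_n) : set 'cV[R]_n :=
  [set map_mx intr U *m x | x in P].

Definition lattice_translate (R : realType) (n : nat) (b : 'cV[int]_n)
    (P : set 'cV[R]_n) : set 'cV[R]_n :=
  [set x + int_pt R b | x in P].

Definition lattice_equiv (R : realType) (n : nat) (P Q : set 'cV[R]_n) : Prop :=
  exists (U : 'M[int]_n) (b : 'cV[int]_n),
    U \in unitmx /\ lattice_translate b (unimodular_image U P) = Q.

Definition pt3 (x y z : int) : 'cV[int]_3 := \col_(i < 3) [:: x; y; z]`_i.

Definition T0 (R : realType) : set 'cV[R]_3 :=
  lattice_conv R [:: pt3 1 0 0; pt3 0 1 0; pt3 (-1) (-1) 0].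

Definition S2 (R : realType) : set 'cV[R]_3 :=
  lattice_conv R [:: pt3 1 0 0; pt3 0 1 0; pt3 0 0 1; pt3 1 1 1].

Definition Q1 (R : realType) : set 'cV[R]_3 :=
  lattice_conv R [:: pt3 0 0 0; pt3 0 0 1; pt3 3 0 (-1)].

Definition Q2 (R : realType) : set 'cV[R]_3 :=
  lattice_conv R [:: pt3 0 0 0; pt3 1 0 0; pt3 0 0 1; pt3 1 2 (-1)].

Arguments T0 R _ : clear implicits.
Arguments S2 R _ : clear implicits.
Arguments Q1 R _ : clear implicits.
Arguments Q2 R _ : clear implicits.

(* Main.v *)
Require Import Defs.
From Stdlib Require Import ZArith Lia.
From mathcomp Require Import all_boot all_order all_algebra.
From mathcomp Require Import ssrZ zify ring lra finmap.
From mathcomp Require Import boolp classical_sets cardinality reals.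

(* If L(T0 + Q) <= 2, then no lattice segment sum [a, a + u] + [0, v] + [0, w]
   has its eight corners in T0 + Q; in particular T0 + Q contains no lattice
   segment of lattice length 3. Applied to lattice points of Q, and up to
   translations, shears fixing the plane of T0 and the symmetries of T0, this
   leaves little room. Two lattice points of Q differ in height by at most 2:
   the prism over a segment with height difference k >= 18 has two lattice
   points congruent modulo 3, and 3 <= k <= 17 is a finite check. Two lattice
   points of Q at the same height differ by +-e1, +-e2 or +-(e1 + e2), so by e1
   after a symmetry; finite checks then show that no third lattice point has
   that height, that none lies two levels away, and that the levels just above
   and just below contain at most one each. Four lattice points therefore
   occupy three consecutive levels as 1 + 2 + 1, Q has no others, and a last
   finite check leaves two positions of the top point relative to the bottom
   one. *)

Set Implicit Arguments.
Unset Strict Implicit.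
Unset Printing Implicit Defensive.

(** * Sets of lattice points without long sums *)

Section LatticeSets.
Local Open Scope Z_scope.

(** Binary integers let the finite checks compute and [lia] apply; [zpt] later turns these triples
    into column vectors. *)
Definition vec := (Z * Z * Z)%type.
Definition quad (T : Type) := (T * T * T * T)%type.

Definition vadd (p q : vec) : vec :=
  let: (x, y, z) := p in let: (x', y', z') := q in (x + x', y + y', z + z').

Definition nonzero (u : vec) : bool :=
  let: (x, y, z) := u in ~~ [&& x =? 0, y =? 0 & z =? 0].

(** The three edge inequalities of T0, scaled by [d] to clear the denominators of convex weights. *)
Definition dilated_T0 (d r s : Z) : bool :=
  [&& r + s <=? d, r - 2 * s <=? d & s - 2 * r <=? d].

(* With d the sum of the weights mu, [in_sum ps mu x] says that x - y lies in T0
   for the convex combination y of the four points ps with coefficients mu/d. *)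
Definition in_sum (ps : quad vec) (mu : quad Z) (x : vec) : bool :=
  let: ((x1, y1, z1), (x2, y2, z2), (x3, y3, z3), (x4, y4, z4)) := ps in
  let: (a, b, c, e) := mu in
  let: (x0, y0, z0) := x in
  let d := a + b + c + e in
  [&& 0 <=? a, 0 <=? b, 0 <=? c, 0 <=? e, 0 <? d,
      d * z0 =? a * z1 + b * z2 + c * z3 + e * z4 &
      dilated_T0 d (d * x0 - (a * x1 + b * x2 + c * x3 + e * x4))
                   (d * y0 - (a * y1 + b * y2 + c * y3 + e * y4))].

Definition corners (a u v w : vec) : seq vec :=
  [:: a; vadd a u; vadd a v; vadd a w; vadd (vadd a u) v; vadd (vadd a u) w;
      vadd (vadd a v) w; vadd (vadd (vadd a u) v) w].

(* For S and P the sets of lattice points of Q and of T0 + Q: the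
   consequences of L(T0 + Q) <= 2 on which the classification rests. *)
Record tight (S P : vec -> Prop) : Prop := Tight {
  tight_sum : forall p1 p2 p3 p4 mu x, S p1 -> S p2 -> S p3 -> S p4 ->
    in_sum (p1, p2, p3, p4) mu x -> P x;
  tight_zonotope : forall a u v w, nonzero u -> nonzero v -> nonzero w ->
    ~ (forall x, x \in corners a u v w -> P x);
  tight_segment : forall a u, nonzero u -> P a ->
    ~ P (vadd a (vadd u (vadd u u))) }.

(* The linear automorphisms of the triangle T0, as matrices [[a, b], [c, e]]. *)
Definition sym_T0 : seq (quad Z) :=
  [:: (1, 0, 0, 1); (1, -1, 0, -1); (0, 1, 1, 0);
      (0, -1, 1, -1); (-1, 1, -1, 0); (-1, 0, -1, 1)].

(** The normalising maps: a symmetry of T0 in the horizontal directions, a shear by [(A, B)] per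
    unit of height, and a translation by [o]. *)
Definition place (g : quad Z) (A B : Z) (o p : vec) : vec :=
  let: (a, b, c, e) := g in let: (x, y, z) := p in
  vadd o (a * x + b * y + A * z, c * x + e * y + B * z, z).

Lemma dilated_T0_sym (a b c e d r s : Z) : (a, b, c, e) \in sym_T0 ->
  dilated_T0 d r s -> dilated_T0 d (a * r + b * s) (c * r + e * s).
Proof.
by rewrite !inE => /or4P[|||/or3P[||]] /eqP[-> -> -> ->]; rewrite /dilated_T0; lia.
Qed.

(** The translation cancels because the weights sum to [d], and the shear only contributes multiples
    of the height equation. *)
Lemma in_sum_place g A B o p1 p2 p3 p4 mu x : g \in sym_T0 ->
  in_sum (p1, p2, p3, p4) mu x ->
  in_sum (place g A B o p1, place g A B o p2, place g A B o p3, place g A B o p4)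
    mu (place g A B o x).
Proof.
case: g => [[[a b] c] e] gS; case: p1 => [[x1 y1] z1]; case: p2 => [[x2 y2] z2].
case: p3 => [[x3 y3] z3]; case: p4 => [[x4 y4] z4]; case: o => [[xo yo] zo].
case: mu => [[[m1 m2] m3] m4]; case: x => [[x y] z]; rewrite /in_sum /place /vadd.
set d := (m1 + m2 + m3 + m4).
case/and5P=> -> -> -> -> /and3P[-> /Z.eqb_eq dz /(dilated_T0_sym gS) dT] /=.
apply/andP; split; first by apply/Z.eqb_eq; rewrite Z.mul_add_distr_l dz /d; ring.
set X := (X in dilated_T0 d X _); set Y := (Y in dilated_T0 d _ Y).
move: dT; congr (dilated_T0 _ _ _).
- rewrite /X; transitivity (a * (d * x - (m1 * x1 + m2 * x2 + m3 * x3 + m4 * x4)) +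
    b * (d * y - (m1 * y1 + m2 * y2 + m3 * y3 + m4 * y4)) +
    A * (d * z - (m1 * z1 + m2 * z2 + m3 * z3 + m4 * z4))); first by rewrite dz; ring.
  by rewrite /d; ring.
- rewrite /Y; transitivity (c * (d * x - (m1 * x1 + m2 * x2 + m3 * x3 + m4 * x4)) +
    e * (d * y - (m1 * y1 + m2 * y2 + m3 * y3 + m4 * y4)) +
    B * (d * z - (m1 * z1 + m2 * z2 + m3 * z3 + m4 * z4))); first by rewrite dz; ring.
  by rewrite /d; ring.
Qed.

(** A computable certificate that T0 plus the hull of [ps] contains a zonotope. Weights are searched
    only among [wts], so the value [false] carries no information. *)
Definition excluded (ps : quad vec) (wts : vec -> seq (quad Z))
    (zs : seq (quad vec)) : bool :=
  has (fun c : quad vec => let: (a, u, v, w) := c in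
    [&& nonzero u, nonzero v, nonzero w &
        all (fun x => has (fun mu => in_sum ps mu x) (wts x)) (corners a u v w)]) zs.

Lemma place_vadd g A B o p u :
  place g A B o (vadd p u) = vadd (place g A B o p) (place g A B (0, 0, 0) u).
Proof.
case: g => [[[a b] c] e]; case: p => [[x y] z]; case: u => [[x' y'] z'].
by case: o => [[xo yo] zo]; rewrite /place /vadd; congr (_, _, _); ring.
Qed.

Lemma nonzero_place g A B u : g \in sym_T0 -> nonzero u ->
  nonzero (place g A B (0, 0, 0) u).
Proof.
case: u => [[x y] z]; rewrite !inE /nonzero.
by case/or4P=> [|||/or3P[||]] /eqP->; rewrite /place /vadd; lia.
Qed.

(** This permits moving points to a normal position before a finite check: corners of a zonotope
    with nonzero edges are sent to corners of another one. *)
Lemma tight_place S P g A B o : tight S P -> g \in sym_T0 ->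
  tight (S \o place g A B o) (P \o place g A B o).
Proof.
move=> T gS; split.
- move=> p1 p2 p3 p4 mu x S1 S2 S3 S4 xmu.
  exact: (tight_sum T S1 S2 S3 S4 (in_sum_place A B o gS xmu)).
- move=> a u v w u0 v0 w0 zon.
  have hu := nonzero_place A B gS u0; have hv := nonzero_place A B gS v0.
  have hw := nonzero_place A B gS w0.
  apply: (tight_zonotope T (a := place g A B o a) hu hv hw) => x.
  have <- : [seq place g A B o y | y <- corners a u v w] =
      corners (place g A B o a) (place g A B (0, 0, 0) u) (place g A B (0, 0, 0) v)
              (place g A B (0, 0, 0) w).
    by rewrite [LHS]map_cons !map_cons !place_vadd.
  by case/mapP=> y /zon Py ->.
- move=> a u u0 /= Pa; rewrite !place_vadd => Pu.
  exact: (tight_segment T (nonzero_place A B gS u0) Pa Pu).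
Qed.

Lemma not_excluded S P p1 p2 p3 p4 wts zs : tight S P ->
  S p1 -> S p2 -> S p3 -> S p4 -> ~ excluded (p1, p2, p3, p4) wts zs.
Proof.
move=> T S1 S2 S3 S4 /hasP[[[[a u] v] w] _ /and4P[u0 v0 w0 /allP zon]].
apply: (tight_zonotope T (a := a) u0 v0 w0) => x /zon /hasP[mu _ xmu].
exact: (tight_sum T S1 S2 S3 S4 xmu).
Qed.

(** * Height differences of lattice points *)

Definition zrange (lo : Z) (n : nat) : seq Z :=
  [seq lo + Z.of_nat i | i <- iota 0 n].

Lemma mem_zrange lo n k : lo <= k < lo + Z.of_nat n -> k \in zrange lo n.
Proof. by move=> h; apply/mapP; exists (Z.to_nat (k - lo)); rewrite ?mem_iota; lia. Qed.

(* Found by computer search: corner and edges of the zonotopes used in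
   [prism_excluded]. *)
Definition prism_zonotopes : seq (quad vec) :=
  [:: ((-1,-1,0), (1,1,1), (1,1,1), (1,1,1));
   ((0,1,0), (0,0,1), (0,0,1), (0,0,1)); ((1,0,0), (0,0,1), (0,0,1), (0,0,1));
   ((1,0,0), (0,1,1), (0,1,1), (0,1,1)); ((0,1,0), (1,0,1), (1,0,1), (1,0,1));
   ((0,0,0), (0,0,1), (0,0,1), (1,1,2)); ((0,0,0), (0,1,1), (0,1,1), (0,1,2));
   ((0,0,0), (1,0,1), (1,0,1), (1,0,2)); ((0,0,0), (0,0,1), (0,0,1), (0,0,1));
   ((0,0,0), (0,1,1), (0,1,1), (0,1,1)); ((0,0,0), (1,0,1), (1,0,1), (1,0,1));
   ((-1,-1,0), (2,3,3), (2,3,3), (2,3,3));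
   ((-1,-1,0), (3,2,3), (3,2,3), (3,2,3));
   ((0,0,0), (1,1,2), (1,1,2), (1,1,2)); ((1,0,0), (0,2,3), (0,2,3), (0,2,3));
   ((0,1,0), (2,0,3), (2,0,3), (2,0,3)); ((0,0,0), (1,1,1), (1,1,1), (1,1,1));
   ((0,0,0), (1,1,1), (1,1,1), (1,2,2)); ((0,0,0), (1,1,1), (1,1,1), (2,1,2));
   ((0,0,0), (1,1,2), (1,1,2), (1,2,4)); ((0,0,0), (1,1,2), (1,1,2), (2,1,4));
   ((0,0,0), (0,1,2), (1,2,3), (1,3,4)); ((0,0,0), (1,2,2), (1,2,3), (2,3,4));
   ((0,0,0), (1,0,2), (2,1,3), (3,1,4)); ((0,0,0), (2,1,2), (2,1,3), (3,2,4));
   ((0,0,0), (0,0,1), (1,1,2), (1,2,4)); ((0,0,0), (0,0,1), (1,1,2), (2,1,4));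
   ((0,0,0), (0,0,1), (1,2,3), (1,2,3)); ((0,0,0), (0,0,1), (2,1,3), (2,1,3));
   ((0,0,0), (0,1,2), (0,1,2), (1,3,4)); ((0,0,0), (1,2,2), (1,2,2), (2,3,4));
   ((0,0,0), (1,0,2), (1,0,2), (3,1,4)); ((0,0,0), (2,1,2), (2,1,2), (3,2,4));
   ((0,0,0), (0,1,2), (0,1,2), (0,1,2)); ((0,0,0), (1,2,2), (1,2,2), (1,2,2));
   ((0,0,0), (1,0,2), (1,0,2), (1,0,2)); ((0,0,0), (2,1,2), (2,1,2), (2,1,2));
   ((0,0,0), (0,0,1), (0,0,1), (1,1,3)); ((0,0,0), (0,0,1), (1,1,2), (1,1,2));
   ((1,3,4), (0,1,1), (0,1,1), (0,1,1)); ((2,3,4), (1,1,1), (1,1,1), (1,1,1));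
   ((3,1,4), (1,0,1), (1,0,1), (1,0,1)); ((3,2,4), (1,1,1), (1,1,1), (1,1,1));
   ((0,0,0), (1,2,3), (1,2,3), (1,2,3)); ((0,0,0), (0,0,1), (1,2,4), (1,2,4));
   ((0,0,0), (0,0,1), (2,1,4), (2,1,4)); ((0,0,0), (2,1,3), (2,1,3), (2,1,3));
   ((0,0,0), (0,1,1), (0,1,1), (1,4,5)); ((0,0,0), (1,1,1), (1,1,1), (3,4,5));
   ((0,0,0), (1,0,1), (1,0,1), (4,1,5)); ((0,0,0), (1,1,1), (1,1,1), (4,3,5));
   ((1,2,4), (0,0,1), (0,0,1), (0,0,1)); ((2,1,4), (0,0,1), (0,0,1), (0,0,1));
   ((0,0,0), (0,1,1), (1,3,4), (1,3,4)); ((0,0,0), (1,1,1), (2,3,4), (2,3,4));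
   ((0,0,0), (1,0,1), (3,1,4), (3,1,4)); ((0,0,0), (1,1,1), (3,2,4), (3,2,4));
   ((0,0,0), (0,0,1), (0,0,1), (1,2,5)); ((0,0,0), (0,0,1), (0,0,1), (2,1,5))].

(* At height j the segment from the origin to (m, n, k) has weights
   (k - j, j). *)
Definition prism_wts (k : Z) (x : vec) : seq (quad Z) := [:: (k - x.2, x.2, 0, 0)].

Lemma prism_excluded k m n : 3 <= k <= 17 -> 0 <= m < k -> 0 <= n < k ->
  excluded ((0, 0, 0), (m, n, k), (0, 0, 0), (0, 0, 0)) (prism_wts k) prism_zonotopes.
Proof.
move=> hk hm hn.
have /allP check : all (fun k => all (fun m => all (fun n =>
  excluded ((0, 0, 0), (m, n, k), (0, 0, 0), (0, 0, 0)) (prism_wts k) prism_zonotopes)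
    (zrange 0 (Z.to_nat k))) (zrange 0 (Z.to_nat k))) (zrange 3 15) by vm_compute.
have k_in : k \in zrange 3 15 by apply: mem_zrange; lia.
have m_in : m \in zrange 0 (Z.to_nat k) by apply: mem_zrange; lia.
have n_in : n \in zrange 0 (Z.to_nat k) by apply: mem_zrange; lia.
by have /allP/(_ m m_in)/allP/(_ n n_in) := check k k_in.
Qed.

(** The lattice translates of T0 cover the plane: each unit square is covered by the four translates
    centred at its corners. Hence T0 + Q has a lattice point at every integral height between two
    lattice points of Q. *)
Lemma exists_dilated_T0 k X Y : 0 < k ->
  exists x y, dilated_T0 k (k * x - X) (k * y - Y).
Proof.
move=> k0; have [eX eY] := (Z.div_mod X k ltac:(lia), Z.div_mod Y k ltac:(lia)).
have [bX bY] := (Z.mod_pos_bound X k k0, Z.mod_pos_bound Y k k0).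
move: (X / k) (X mod k) (Y / k) (Y mod k) eX eY bX bY => i r j s -> -> hr hs.
rewrite /dilated_T0.
have [?|?] := Z_le_gt_dec k (r + s); first by exists (i + 1), (j + 1); lia.
have [?|?] := Z_lt_ge_dec k (2 * s - r); first by exists i, (j + 1); lia.
have [?|?] := Z_lt_ge_dec k (2 * r - s); first by exists (i + 1), j; lia.
by exists i, j; lia.
Qed.

(** With the heights congruent, only nine residue classes modulo 3 remain for ten points. Two
    distinct points in one class span a segment as in [tight_segment]. *)
Lemma congruent_pair (f : nat -> vec) (z : Z) :
    (forall i j, (i < j < 10)%N -> f i <> f j) ->
    (forall i, (i < 10)%N -> (f i).2 mod 3 = z) ->
  exists i j u, [/\ (i < 10)%N, (j < 10)%N, nonzero u &
    f j = vadd (f i) (vadd u (vadd u u))].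
Proof.
move=> finj fz.
pose h (i : 'I_10) : 'I_3 * 'I_3 :=
  (inord (Z.to_nat ((f i).1.1 mod 3)), inord (Z.to_nat ((f i).1.2 mod 3))).
have /injectivePn[i [j ij]] : ~~ injectiveb h.
  by apply/negP=> /injectiveP/leq_card; rewrite card_prod !card_ord.
case=> /(congr1 (@nat_of_ord _)) ex /(congr1 (@nat_of_ord _)) ey.
have mod3 a : (Z.to_nat (a mod 3) < 3)%N by have := Z.mod_pos_bound a 3; lia.
have mod3_inj a b : Z.to_nat (a mod 3) = Z.to_nat (b mod 3) -> a mod 3 = b mod 3.
  by have := Z.mod_pos_bound a 3; have := Z.mod_pos_bound b 3; lia.
move: ex ey; rewrite !inordK ?mod3 // => /mod3_inj ex /mod3_inj ey.
have fij : f i <> f j.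
  have : (val i != val j) by [].
  rewrite neq_ltn => /orP[lt|lt]; first by apply: finj; rewrite lt ltn_ord.
  by apply/nesym/finj; rewrite lt ltn_ord.
have := fz i (ltn_ord i); have := fz j (ltn_ord j); move: ex ey fij.
case ei : (f i) => [[xi yi] zi]; case ej : (f j) => [[xj yj] zj] /= ex ey fij ezj ezi.
exists i, j, ((xj - xi) / 3, (yj - yi) / 3, (zj - zi) / 3).
have div3 a b : a mod 3 = b mod 3 -> 3 * ((b - a) / 3) = b - a.
  by have := Z.div_mod a 3 ltac:(lia); have := Z.div_mod b 3 ltac:(lia);
     have := Z.div_mod (b - a) 3 ltac:(lia); have := Z.mod_pos_bound (b - a) 3 ltac:(lia);
     have := Z.mod_pos_bound a 3 ltac:(lia); lia.
have [[hx hy] hz] := (div3 _ _ ex, div3 _ _ ey, div3 zi zj (etrans ezi (esym ezj))).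
split; [exact: ltn_ord | exact: ltn_ord | | ]; last first.
  by rewrite ei ej; congr (_, _, _); lia.
apply/negP=> /and3P[/Z.eqb_eq x0 /Z.eqb_eq y0 /Z.eqb_eq z0].
by apply: fij; congr (_, _, _); lia.
Qed.

(* For a height difference k >= 18, the four lattice points of T0 at the bottom
   and one lattice point at each of the heights 3, 6, ..., 18 are ten points in
   nine classes modulo 3. *)
Lemma height_diff_le2 S P p q : tight S P -> S p -> S q -> q.2 - p.2 <= 2.
Proof.
move=> T; case: p => [[x0 y0] z0]; case: q => [[x1 y1] z1] /= Sp Sq.
have [//|k3] : z1 - z0 <= 2 \/ 3 <= z1 - z0 by lia.
exfalso; pose k := z1 - z0.
have [k17|k18] : k <= 17 \/ 18 <= k by lia.
  have kk : k <> 0 by lia.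
  have [ex ey] := (Z.div_mod (x1 - x0) k kk, Z.div_mod (y1 - y0) k kk).
  have hm := Z.mod_pos_bound (x1 - x0) k ltac:(lia).
  have hn := Z.mod_pos_bound (y1 - y0) k ltac:(lia).
  (* The shear by the quotients reduces the horizontal displacement modulo [k], to the range of
     [prism_excluded]. *)
  have T' := tight_place ((x1 - x0) / k) ((y1 - y0) / k) (x0, y0, z0) T
               (mem_head _ _ : (1, 0, 0, 1) \in sym_T0).
  have S0 : (S \o place (1, 0, 0, 1) ((x1 - x0) / k) ((y1 - y0) / k) (x0, y0, z0)) (0, 0, 0).
    by move: Sp; congr S; rewrite /place /vadd; congr (_, _, _); ring.
  apply: (not_excluded T' S0 _ S0 S0 (prism_excluded (conj k3 k17) hm hn)).
  move: Sq; congr S; rewrite /place /vadd; congr (_, _, _); last by rewrite /k; lia.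
  - by rewrite Z.mul_0_l Z.mul_1_l Z.add_0_r; lia.
  - by rewrite Z.mul_0_l Z.mul_1_l; lia.
(* [h i] lies in the translate of T0 centred at the point of the segment [3 i] levels up; [i <= 6]
   stays on the segment because [18 <= k]. *)
have [h hP] : exists h : nat -> vec, forall i, (i <= 6)%N ->
    P (h i) /\ (h i).2 = z0 + 3 * Z.of_nat i.
  have /choice[h hh] : forall i, exists x : vec, (i <= 6)%N ->
      P x /\ x.2 = z0 + 3 * Z.of_nat i.
    move=> i; pose j := 3 * Z.of_nat i.
    have [x [y xy]] := @exists_dilated_T0 k ((k - j) * x0 + j * x1) ((k - j) * y0 + j * y1)
      ltac:(lia).
    exists (x, y, z0 + j) => i6; split=> //.
    apply: (tight_sum T Sp Sq Sp Sp (mu := (k - j, j, 0, 0))).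
    rewrite /in_sum; have -> : k - j + j + 0 + 0 = k by ring.
    by rewrite !Z.mul_0_l !Z.add_0_r xy andbT /j; apply/and5P; split; lia.
  by exists h.
pose T0s : seq vec := [:: (1, 0, 0); (0, 1, 0); (-1, -1, 0); (0, 0, 0)].
(* Truncated subtraction makes [i - 3] vanish for the four bottom points, so one height formula
   serves all ten indices. *)
pose f i := if (i < 4)%N then vadd (x0, y0, z0) (nth (0, 0, 0) T0s i) else h (i - 3)%N.
have fz i : (i < 10)%N -> (f i).2 = z0 + 3 * Z.of_nat (i - 3).
  rewrite /f; case: (ltnP i 4) => [|i4 i10]; last by case: (hP (i - 3)%N ltac:(lia)).
  by case: i => [|[|[|[|?]]]] //= _ _; lia.
have f_inj i j : (i < j < 10)%N -> f i <> f j.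
  move=> lt; have [j4|j4] := ltnP j 4; last by move/(congr1 snd); rewrite !fz; lia.
  have i4 : (i < 4)%N by lia.
  rewrite /f j4 i4 => eij.
  have /eqP : nth (0, 0, 0) T0s i = nth (0, 0, 0) T0s j.
    move: eij; case: (nth _ _ i) => [[? ?] ?]; case: (nth _ _ j) => [[? ?] ?] [? ? ?].
    by congr (_, _, _); lia.
  by rewrite nth_uniq // => /eqP ij; move: lt; rewrite ij ltnn.
have f_mod i : (i < 10)%N -> (f i).2 mod 3 = z0 mod 3.
  by move=> i10; rewrite fz // Z.mul_comm Z_mod_plus_full.
have [i [j [u [i10 j10 u0 eij]]]] := congruent_pair f_inj f_mod.
have fP n : (n < 10)%N -> P (f n).
  rewrite /f; case: (ltnP n 4) => [|n4 n10]; last by case: (hP (n - 3)%N ltac:(lia)).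
  move=> n4 _; apply: (tight_sum T Sp Sp Sp Sp (mu := (1, 0, 0, 0))).
  have : nth (0, 0, 0) T0s n \in T0s by rewrite mem_nth.
  by rewrite !inE => /or4P[] /eqP->; rewrite /in_sum /vadd /dilated_T0; lia.
apply: (tight_segment T u0 (fP i i10)); rewrite -eij; exact: fP.
Qed.

(** * Bounds from the slice halfway between two lattice points *)

(* The ends of the segment lie in T0 + p and in T0 + y, where y is the point at
   parameter 2 i / d on the segment from p to the midpoint of t and b. *)
Lemma slice_segment S P x y z tx ty tz bx b_y bz c1 c2 u1 u2 d i : tight S P ->
  S (x, y, z) -> S (tx, ty, tz) -> S (bx, b_y, bz) -> tz + bz = 2 * z ->
  dilated_T0 1 c1 c2 -> nonzero (u1, u2, 0) -> 0 < d -> 0 <= 2 * i <= d -> 0 <= i ->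
  ~ dilated_T0 d (d * (c1 + 3 * u1) - i * (tx + bx - 2 * x))
                 (d * (c2 + 3 * u2) - i * (ty + b_y - 2 * y)).
Proof.
move=> T Sp St Sb tb cT u0 d0 id i0 cuT.
have Pc : P (x + c1, y + c2, z).
  apply: (tight_sum T Sp Sp Sp Sp (mu := (1, 0, 0, 0))).
  by move: cT; rewrite /in_sum /dilated_T0; lia.
apply: (tight_segment T u0 Pc).
apply: (tight_sum T Sp St Sb Sp (mu := (d - 2 * i, i, i, 0))).
rewrite /in_sum /vadd; have -> : d - 2 * i + i + i + 0 = d by ring.
apply/and5P; split; try lia; apply/and3P; split; first by lia.
  have -> : tz = 2 * z - bz by lia.
  by apply/Z.eqb_eq; ring.
by move: cuT; congr (is_true (dilated_T0 _ _ _)); ring.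
Qed.

(** If the midpoint of the outer points is far from the middle one, the slice has a horizontal
    segment of lattice length 3. Write f1, f2 for the images of e1, e2 under the symmetry. In
    [coneA] the parameter is chosen to move 3 along f1, and the segment starts at the vertex f2; in
    [coneB] it moves 2 along -f1, and the segment runs from f1 to -2 f1. *)
Lemma slice_bound S P x y z tx ty tz bx b_y bz : tight S P ->
  S (x, y, z) -> S (tx, ty, tz) -> S (bx, b_y, bz) -> tz + bz = 2 * z ->
  -5 <= tx + bx - 2 * x <= 5 /\ -5 <= ty + b_y - 2 * y <= 5.
Proof.
move=> T Sp St Sb tb; set m := tx + _ - _; set n := ty + _ - _.
(* The images of these two cones under the symmetries of T0 cover the plane. *)
have coneA g1 g2 g3 g4 X Y : (g1, g2, g3, g4) \in sym_T0 ->
    m = g1 * X + g2 * Y -> n = g3 * X + g4 * Y -> 0 <= 2 * Y <= X -> X <= 5.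
  move=> gS em en hY; have [//|X6] : X <= 5 \/ 6 <= X by lia.
  case: (slice_segment T Sp St Sb tb (c1 := g2) (c2 := g4) (u1 := g1) (u2 := g3)
           (d := X) (i := 3)) => //; try lia; rewrite -/m -/n ?em ?en; move: gS;
    rewrite !inE => /or4P[|||/or3P[||]] /eqP[? ? ? ?];
    by subst g1 g2 g3 g4; rewrite /dilated_T0 /nonzero; lia.
have coneB g1 g2 g3 g4 X Y : (g1, g2, g3, g4) \in sym_T0 ->
    m = - (g1 * X + g2 * Y) -> n = - (g3 * X + g4 * Y) -> 0 <= 2 * Y <= X -> X <= 3.
  move=> gS em en hY; have [//|X4] : X <= 3 \/ 4 <= X by lia.
  case: (slice_segment T Sp St Sb tb (c1 := g1) (c2 := g3) (u1 := - g1) (u2 := - g3)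
           (d := X) (i := 2)) => //; try lia; rewrite -/m -/n ?em ?en; move: gS;
    rewrite !inE => /or4P[|||/or3P[||]] /eqP[? ? ? ?];
    by subst g1 g2 g3 g4; rewrite /dilated_T0 /nonzero; lia.
move: m n coneA coneB => m n coneA coneB.
have [n0|n0] := Z_le_gt_dec 0 n.
  have [mn|mn] := Z_le_gt_dec n m.
    have [?|?] := Z_le_gt_dec (2 * n) m; first by
      have := coneA 1 0 0 1 m n isT ltac:(lia) ltac:(lia) ltac:(lia);
      lia.
    by have := coneB (-1) 0 (-1) 1 m (m - n) isT ltac:(lia) ltac:(lia) ltac:(lia); lia.
  have [m0|m0] := Z_le_gt_dec 0 m.
    have [?|?] := Z_le_gt_dec n (2 * m); first by
      have := coneB (-1) 1 (-1) 0 n (n - m) isT ltac:(lia) ltac:(lia) ltac:(lia);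
      lia.
    by have := coneA 0 1 1 0 n m isT ltac:(lia) ltac:(lia) ltac:(lia); lia.
  have [?|?] := Z_le_gt_dec 0 (m + n); first by
    have := coneA 0 (-1) 1 (-1) (n - m) (- m) isT ltac:(lia) ltac:(lia) ltac:(lia);
    lia.
  by have := coneB 1 (-1) 0 (-1) (n - m) n isT ltac:(lia) ltac:(lia) ltac:(lia); lia.
have [mn|mn] := Z_le_gt_dec m n.
  have [?|?] := Z_le_gt_dec m (2 * n); first by
    have := coneB 1 0 0 1 (- m) (- n) isT ltac:(lia) ltac:(lia) ltac:(lia);
    lia.
  by have := coneA (-1) 0 (-1) 1 (- m) (n - m) isT ltac:(lia) ltac:(lia) ltac:(lia); lia.
have [m0|m0] := Z_le_gt_dec m 0.
  have [?|?] := Z_le_gt_dec (2 * m) n; first by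
    have := coneA (-1) 1 (-1) 0 (- n) (m - n) isT ltac:(lia) ltac:(lia) ltac:(lia);
    lia.
  by have := coneB 0 1 1 0 (- n) (- m) isT ltac:(lia) ltac:(lia) ltac:(lia); lia.
have [?|?] := Z_le_gt_dec 0 (m + n); first by
  have := coneA 1 (-1) 0 (-1) (m - n) (- n) isT ltac:(lia) ltac:(lia) ltac:(lia);
  lia.
by have := coneB 0 (-1) 1 (-1) (m - n) m isT ltac:(lia) ltac:(lia) ltac:(lia); lia.
Qed.

(** * Finite checks on small configurations *)

(* Found by computer search, like the weights below, for the five finite checks
   that follow. *)
Definition config_zonotopes : seq (quad vec) :=
  [:: ((-1,0,0), (1,0,0), (1,0,0), (1,0,0));
   ((-1,-1,0), (1,0,0), (1,0,0), (1,1,0));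
   ((-1,-1,0), (1,0,0), (1,1,0), (1,1,0));
   ((0,-2,0), (0,1,0), (0,1,0), (0,1,0));
   ((0,-1,0), (0,1,0), (0,1,0), (1,1,0));
   ((-2,0,0), (1,0,0), (1,0,0), (1,0,0));
   ((-2,2,0), (1,-1,0), (1,-1,0), (1,0,0));
   ((-1,-2,0), (0,1,0), (1,1,0), (1,1,0));
   ((-1,-1,0), (1,1,0), (1,1,0), (1,1,0));
   ((0,-1,0), (0,0,1), (0,1,0), (0,1,0));
   ((-1,-1,-1), (0,0,1), (1,1,0), (1,1,0));
   ((-1,-1,0), (0,1,0), (0,1,0), (1,1,0));
   ((-1,-1,0), (0,0,1), (1,1,0), (1,1,0));
   ((-1,-1,-1), (0,0,1), (1,0,0), (1,1,0));
   ((-2,-1,0), (1,-1,0), (1,1,0), (1,1,0));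
   ((-1,-1,0), (0,0,1), (0,0,1), (1,2,0));
   ((0,0,-2), (0,0,1), (0,0,1), (1,0,0));
   ((0,1,0), (0,0,1), (0,0,1), (1,0,0));
   ((0,1,-2), (0,0,1), (0,0,1), (1,0,0));
   ((1,1,0), (0,0,1), (0,0,1), (1,-1,0));
   ((0,-1,-2), (0,0,1), (0,0,1), (1,2,0));
   ((0,0,0), (0,0,1), (0,0,1), (1,1,0));
   ((-1,-1,0), (1,0,0), (1,1,-1), (1,1,-1));
   ((-1,0,1), (1,0,-1), (1,0,0), (1,0,0));
   ((-1,0,-1), (1,0,0), (1,0,0), (1,0,1));
   ((-1,-1,-1), (0,0,1), (1,0,0), (1,1,1));
   ((0,-1,-1), (0,0,1), (0,1,0), (0,1,1));
   ((0,0,-1), (0,0,1), (0,0,1), (1,0,0));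
   ((0,0,0), (0,0,1), (0,1,-1), (1,0,0));
   ((0,-1,0), (0,1,0), (0,1,1), (1,0,-1));
   ((-1,-1,0), (0,0,1), (1,0,-1), (1,1,0));
   ((0,0,1), (0,1,-1), (1,0,-1), (1,0,0));
   ((0,0,1), (0,1,0), (1,0,-1), (1,0,-1));
   ((-1,-1,1), (1,0,-1), (1,1,-1), (1,1,0))].

Definition config_wts : seq (quad Z) :=
  [:: (0,0,0,1); (0,0,1,0); (0,1,0,0); (1,0,0,0); (0,0,0,2); (0,0,1,1);
      (0,0,2,0); (0,1,0,1); (0,1,1,0); (0,2,0,0); (1,0,0,1); (1,0,1,0);
      (1,1,0,0); (2,0,0,0); (0,0,0,3); (0,0,1,2); (0,0,2,1); (0,0,3,0);
      (0,1,0,2); (0,1,1,1); (0,1,2,0); (0,2,0,1); (0,2,1,0); (0,3,0,0);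
      (1,0,0,2); (1,0,1,1); (1,0,2,0); (1,1,0,1); (1,1,1,0); (1,2,0,0);
      (2,0,0,1); (2,0,1,0); (2,1,0,0); (3,0,0,0); (2,1,1,0); (0,2,2,0);
      (3,1,1,0); (1,2,2,0); (4,1,1,0); (2,2,2,0); (0,3,3,0)].
Notation config_excluded p1 p2 p3 p4 :=
  (excluded (p1, p2, p3, p4) (fun=> config_wts) config_zonotopes).

(** The vertices of T0, then their negatives: two orbits under the symmetries of T0. *)
Definition unit_steps : seq (Z * Z) :=
  [:: (1, 0); (0, 1); (-1, -1); (-1, 0); (0, -1); (1, 1)].

Lemma flat_pair_excluded m n : m \in zrange (-2) 5 -> n \in zrange (-2) 5 ->
  (m, n) \notin (0, 0) :: unit_steps ->
  config_excluded (0, 0, 0) (m, n, 0) (0, 0, 0) (0, 0, 0).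
Proof.
move=> hm hn mn.
have /allP/(_ m hm)/allP/(_ n hn) : all (fun m => all (fun n =>
  ((m, n) \in (0, 0) :: unit_steps) ||
  config_excluded (0, 0, 0) (m, n, 0) (0, 0, 0) (0, 0, 0)) (zrange (-2) 5))
  (zrange (-2) 5) by vm_compute.
by rewrite (negbTE mn).
Qed.

Lemma flat_triple_excluded s : s \in unit_steps -> s != (1, 0) ->
  config_excluded (0, 0, 0) (1, 0, 0) (s.1, s.2, 0) (0, 0, 0).
Proof.
move=> hs s1.
have /allP/(_ s hs) : all (fun s => (s == (1, 0)) ||
  config_excluded (0, 0, 0) (1, 0, 0) (s.1, s.2, 0) (0, 0, 0)) unit_steps by vm_compute.
by rewrite (negbTE s1).
Qed.

(** Parities suffice here, since a shear moves points at height 2 or -2 by even amounts. *)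
Lemma two_levels_excluded m n s : m \in [:: 0; 1] -> n \in [:: 0; 1] -> s \in [:: 2; -2] ->
  config_excluded (0, 0, 0) (1, 0, 0) (m, n, s) (0, 0, 0).
Proof.
move=> hm hn hs.
have /allP/(_ m hm)/allP/(_ n hn)/allP/(_ s hs) : all (fun m => all (fun n => all (fun s =>
  config_excluded (0, 0, 0) (1, 0, 0) (m, n, s) (0, 0, 0)) [:: 2; -2]) [:: 0; 1]) [:: 0; 1]
  by vm_compute.
by [].
Qed.

Lemma two_pairs_excluded s h : s \in unit_steps -> h \in [:: 1; -1] ->
  config_excluded (0, 0, 0) (1, 0, 0) (0, 0, h) (s.1, s.2, h).
Proof.
move=> hs hh.
have /allP/(_ s hs)/allP/(_ h hh) : all (fun s => all (fun h =>
  config_excluded (0, 0, 0) (1, 0, 0) (0, 0, h) (s.1, s.2, h)) [:: 1; -1]) unit_steps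
  by vm_compute.
by [].
Qed.

(** Of the exceptions, [(3, 0)] leads to [Q1] and [(1, 2)] to [Q2]; [(-1, -2)] is the mirror image
    of [(1, 2)] under the symmetry of T0 that fixes e1. *)
Lemma tetra_excluded m n : m \in zrange (-5) 11 -> n \in zrange (-5) 11 ->
  (m, n) \notin [:: (3, 0); (1, 2); (-1, -2)] ->
  config_excluded (0, 0, 0) (0, 0, 1) (m, n, -1) (1, 0, 0).
Proof.
move=> hm hn mn.
have /allP/(_ m hm)/allP/(_ n hn) : all (fun m => all (fun n =>
  ((m, n) \in [:: (3, 0); (1, 2); (-1, -2)]) ||
  config_excluded (0, 0, 0) (0, 0, 1) (m, n, -1) (1, 0, 0)) (zrange (-5) 11))
  (zrange (-5) 11) by vm_compute.
by rewrite (negbTE mn).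
Qed.

(** * Lattice points level by level *)

Lemma place1E A B x0 y0 z0 x y z : place (1, 0, 0, 1) A B (x0, y0, z0) (x, y, z) =
  (x0 + (x + A * z), y0 + (y + B * z), z0 + z).
Proof. by rewrite /place /vadd; congr (_, _, _); ring. Qed.

Lemma place_flat A B x y : place (1, 0, 0, 1) A B (0, 0, 0) (x, y, 0) = (x, y, 0).
Proof. by rewrite place1E; congr (_, _, _); ring. Qed.

Lemma flat_steps S P x y z x' y' : tight S P -> S (x, y, z) -> S (x', y', z) ->
  (x' - x, y' - y) \in (0, 0) :: unit_steps.
Proof.
(* Taking both outer points equal to the second point bounds twice the displacement by 5, hence each
   coordinate by 2. *)
move=> T Sp Sq; have [bx b_y] := slice_bound T Sp Sq Sq ltac:(lia).
have T' := tight_place 0 0 (x, y, z) T (mem_head _ _ : (1, 0, 0, 1) \in sym_T0).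
apply: contraT => /flat_pair_excluded excl; exfalso.
apply: (not_excluded T' _ _ _ _ (excl _ _)); rewrite ?mem_zrange ?/comp ?place1E; try lia.
- by move: Sp; congr S; congr (_, _, _); ring.
- by move: Sq; congr S; congr (_, _, _); ring.
- by move: Sp; congr S; congr (_, _, _); ring.
- by move: Sp; congr S; congr (_, _, _); ring.
Qed.

Section WithUnitStep.
Variables S P : vec -> Prop.
Hypotheses (T : tight S P) (S0 : S (0, 0, 0)) (S1 : S (1, 0, 0)).

Lemma level0 m n : S (m, n, 0) -> (m, n) = (0, 0) \/ (m, n) = (1, 0).
Proof.
move=> Sx; have := flat_steps T S0 Sx; rewrite !Z.sub_0_r in_cons.
case/predU1P=> [|mn]; first by left.
have [|mn1] := eqVneq (m, n) (1, 0); first by right.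
by case: (not_excluded T S0 S1 Sx S0 (flat_triple_excluded mn mn1)).
Qed.

Lemma level_le1 m n h : S (m, n, h) -> -1 <= h <= 1.
Proof.
move=> Sx; have hi := height_diff_le2 T S0 Sx; have lo := height_diff_le2 T Sx S0.
have [//|h2] : -1 <= h <= 1 \/ h = 2 \/ h = -2 by move: hi lo => /=; lia.
(* The factor [h / 2] is the sign of [h], so at height [h] this shear accounts for [2 * (m / 2)] and
   [2 * (n / 2)], leaving the parities. *)
exfalso; pose A := m / 2 * (h / 2); pose B := n / 2 * (h / 2).
have T' := tight_place A B (0, 0, 0) T (mem_head _ _ : (1, 0, 0, 1) \in sym_T0).
have mod2 a : a mod 2 \in [:: 0; 1].
  have [->|->] // : a mod 2 = 0 \/ a mod 2 = 1 by have := Z.mod_pos_bound a 2; lia.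
have hS : h \in [:: 2; -2] by case: h2 => ->.
apply: (not_excluded T' _ _ _ _ (two_levels_excluded (mod2 m) (mod2 n) hS));
  rewrite /comp ?place_flat //.
have [em en] := (Z.div_mod m 2 ltac:(lia), Z.div_mod n 2 ltac:(lia)).
move: Sx; congr S; rewrite place1E {1}em {1}en /A /B.
have [e2 e_2] : 2 / 2 = 1 /\ -2 / 2 = -1 by [].
by case: h2 => ->; rewrite ?e2 ?e_2; congr (_, _, _); lia.
Qed.

Lemma level_unique m n m' n' h : h = 1 \/ h = -1 ->
  S (m, n, h) -> S (m', n', h) -> (m, n) = (m', n').
Proof.
move=> h1 Sx Sy; have := flat_steps T Sx Sy; rewrite in_cons.
case/predU1P=> [[? ?]|s]; first by congr (_, _); lia.
have hS : h \in [:: 1; -1] by rewrite !inE; case: h1 => ->.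
(* As [h * h = 1], this shear brings [(0, 0, h)] to [(m, n, h)]. *)
have T' := tight_place (m * h) (n * h) (0, 0, 0) T (mem_head _ _ : (1, 0, 0, 1) \in sym_T0).
case: (not_excluded T' _ _ _ _ (two_pairs_excluded s hS));
  rewrite /comp ?place_flat // place1E.
- by move: Sx; congr S; case: h1 => ->; congr (_, _, _); ring.
- by move: Sy; congr S; case: h1 => ->; congr (_, _, _); rewrite /fst /snd; ring.
Qed.

(** The two sums are invariant under shears; with the top point sheared to [(0, 0, 1)] they are the
    position of the bottom one. [slice_bound] at the origin makes the check finite. *)
Lemma opposite_levels m n m' n' : S (m, n, 1) -> S (m', n', -1) ->
  (m + m', n + n') \in [:: (3, 0); (1, 2); (-1, -2)].
Proof.
move=> St Sb; have [bx b_y] := slice_bound T S0 St Sb ltac:(lia).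
have T' := tight_place m n (0, 0, 0) T (mem_head _ _ : (1, 0, 0, 1) \in sym_T0).
apply: contraT => /tetra_excluded excl; exfalso.
apply: (not_excluded T' _ _ _ _ (excl _ _)); rewrite ?mem_zrange /comp ?place_flat //; try lia;
  rewrite place1E.
- by move: St; congr S; congr (_, _, _); ring.
- by move: Sb; congr S; congr (_, _, _); ring.
Qed.

End WithUnitStep.

(** * Classification of four lattice points *)

Definition model (m n : Z) : seq vec := [:: (0, 0, 0); (1, 0, 0); (0, 0, 1); (m, n, -1)].

Lemma tight_model S P m n : tight S P -> (forall x, x \in model m n -> S x) ->
  forall x, S x -> x \in model m n.
Proof.
move=> T Sm [[a b] h] Sx.
have S0 : S (0, 0, 0) by apply: Sm; rewrite !inE eqxx.
have S1 : S (1, 0, 0) by apply: Sm; rewrite !inE eqxx orbT.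
have [h0|[h1|h1]] : h = 0 \/ h = 1 \/ h = -1 by have := level_le1 T S0 S1 Sx; lia.
- rewrite h0 in Sx *; case: (level0 T S0 S1 Sx) => -[-> ->]; by rewrite !inE eqxx ?orbT.
- rewrite h1 in Sx *; have St : S (0, 0, 1) by apply: Sm; rewrite !inE eqxx !orbT.
  by have [-> ->] := level_unique T S0 S1 (or_introl erefl) Sx St; rewrite !inE eqxx !orbT.
- rewrite h1 in Sx *; have Sb : S (m, n, -1) by apply: Sm; rewrite !inE eqxx !orbT.
  by have [-> ->] := level_unique T S0 S1 (or_intror erefl) Sx Sb; rewrite !inE eqxx !orbT.
Qed.

Lemma place_comp g g' A B A' B' o o' : g \in sym_T0 -> g' \in sym_T0 ->
  exists g2 A2 B2 o2, g2 \in sym_T0 /\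
    forall x, place g A B o (place g' A' B' o' x) = place g2 A2 B2 o2 x.
Proof.
case: g => [[[a b] c] e]; case: g' => [[[a' b'] c'] e'] gS gS'.
exists (a * a' + b * c', a * b' + b * e', c * a' + e * c', c * b' + e * e').
exists (a * A' + b * B' + A), (c * A' + e * B' + B), (place (a, b, c, e) A B o o').
split=> [|[[x y] z]]; last first.
  case: o o' => [[xo yo] zo] [[xo' yo'] zo'].
  by rewrite /place /vadd; congr (_, _, _); ring.
have /allP/(_ _ gS)/allP/(_ _ gS') // : all (fun g => all (fun g' =>
  let: ((a, b, c, e), (a', b', c', e')) := (g, g') in
  (a * a' + b * c', a * b' + b * e', c * a' + e * c', c * b' + e * e') \in sym_T0)
  sym_T0) sym_T0 by [].
Qed.

Lemma place_surj g A B o x : g \in sym_T0 -> exists y, place g A B o y = x.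
Proof.
case: x o => [[x y] z] [[xo yo] zo]; rewrite !inE.
pose X := x - xo - A * (z - zo); pose Y := y - yo - B * (z - zo).
case/or4P=> [|||/or3P[||]] /eqP->; [
  exists (X, Y, z - zo) | exists (X - Y, - Y, z - zo) | exists (Y, X, z - zo) |
  exists (Y - X, - X, z - zo) | exists (- Y, X - Y, z - zo) |
  exists (- X, Y - X, z - zo)];
  by rewrite /place /vadd /X /Y; congr (_, _, _); ring.
Qed.

Definition classified (S : vec -> Prop) : Prop :=
  exists g A B o m n, [/\ g \in sym_T0, (m, n) = (3, 0) \/ (m, n) = (1, 2) &
    forall x, S (place g A B o x) <-> x \in model m n].

Lemma classified_place S g A B o : g \in sym_T0 ->
  classified (S \o place g A B o) -> classified S.
Proof.
move=> gS [g' [A' [B' [o' [m [n [gS' mn eqS]]]]]]].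
have [g2 [A2 [B2 [o2 [gS2 eq2]]]]] := place_comp A B A' B' o o' gS gS'.
by exists g2, A2, B2, o2, m, n; split=> // x; rewrite -eq2; exact: eqS.
Qed.

(** A shear by [(m, n)] puts the model's top point in place. In the mirror case the reflection
    [(1, -1, 0, -1)], which fixes e1, is applied as well. *)
Lemma classified_levels S P m n m' n' : tight S P -> S (0, 0, 0) -> S (1, 0, 0) ->
  S (m, n, 1) -> S (m', n', -1) -> classified S.
Proof.
move=> T S0 S1 St Sb.
suff model_in g k l : g \in sym_T0 -> (k, l) = (3, 0) \/ (k, l) = (1, 2) ->
    place g m n (0, 0, 0) (1, 0, 0) = (1, 0, 0) ->
    place g m n (0, 0, 0) (k, l, -1) = (m', n', -1) -> classified S.
  have := opposite_levels T S0 S1 St Sb; rewrite !inE => /or3P[] /eqP[em en].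
  - apply: (model_in (1, 0, 0, 1) 3 0) => //; [by left | by rewrite place_flat |].
    by rewrite place1E; congr (_, _, _); lia.
  - apply: (model_in (1, 0, 0, 1) 1 2) => //; [by right | by rewrite place_flat |].
    by rewrite place1E; congr (_, _, _); lia.
  - apply: (model_in (1, -1, 0, -1) 1 2) => //; first by right.
      by rewrite /place /vadd; congr (_, _, _); ring.
    by rewrite /place /vadd; congr (_, _, _); lia.
move=> gS kl e1 eb; have T' := tight_place m n (0, 0, 0) T gS.
exists g, m, n, (0, 0, 0), k, l; split=> // x; split.
  apply: (tight_model T') => y.
  rewrite !inE => /or4P[] /eqP-> /=; rewrite ?e1 ?eb //.
    by move: S0; congr S; case: g {gS e1 eb T'} => [[[a b] c] e];
       rewrite /place /vadd; congr (_, _, _); ring.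
  by move: St; congr S; case: g {gS e1 eb T'} => [[[a b] c] e];
     rewrite /place /vadd; congr (_, _, _); ring.
rewrite !inE => /or4P[] /eqP-> /=; rewrite ?e1 ?eb //.
  by move: S0; congr S; case: g {gS e1 eb T'} => [[[a b] c] e];
     rewrite /place /vadd; congr (_, _, _); ring.
by move: St; congr S; case: g {gS e1 eb T'} => [[[a b] c] e];
   rewrite /place /vadd; congr (_, _, _); ring.
Qed.

(** Level 0 is full and the levels 1 and -1 hold at most one point each, so [r] and [s] lie on
    opposite sides. *)
Lemma classified_unit_step S P r s : tight S P -> S (0, 0, 0) -> S (1, 0, 0) ->
  S r -> S s -> uniq [:: (0, 0, 0); (1, 0, 0); r; s] -> classified S.
Proof.
move=> T S0 S1; case: r s => [[a b] h] [[a' b'] h'] Sr Ss un.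
have lev x y z : S (x, y, z) -> (x, y, z) <> (0, 0, 0) -> (x, y, z) <> (1, 0, 0) ->
    z = 1 \/ z = -1.
  move=> Sx x0 x1; have := level_le1 T S0 S1 Sx => z1.
  have [z0|?] : z = 0 \/ z <> 0 by lia.
    by rewrite z0 in Sx x0 x1; case: (level0 T S0 S1 Sx) => -[ex ey];
       [case: x0 | case: x1]; rewrite ex ey.
  by lia.
move: un; rewrite /= !inE !negb_or => /and4P[/and3P[_ /eqP r0 /eqP s0]].
case/andP=> /eqP r1 /eqP s1 /eqP rs _.
case: (lev _ _ _ Sr (nesym r0) (nesym r1)) => eh;
  case: (lev _ _ _ Ss (nesym s0) (nesym s1)) => eh'.
- by rewrite eh eh' in Sr Ss rs; case: rs;
     have [-> ->] := level_unique T S0 S1 (or_introl erefl) Sr Ss.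
- by rewrite eh eh' in Sr Ss; apply: classified_levels T S0 S1 Sr Ss.
- by rewrite eh eh' in Sr Ss; apply: classified_levels T S0 S1 Ss Sr.
- by rewrite eh eh' in Sr Ss rs; case: rs;
     have [-> ->] := level_unique T S0 S1 (or_intror erefl) Sr Ss.
Qed.

Lemma classified_place_step S P p q r s g : tight S P -> S p -> S q -> S r -> S s ->
  uniq [:: p; q; r; s] -> g \in sym_T0 -> place g 0 0 p (1, 0, 0) = q -> classified S.
Proof.
move=> T Sp Sq Sr Ss un gS eq; apply: (classified_place (A := 0) (B := 0) (o := p) gS).
have ep : place g 0 0 p (0, 0, 0) = p.
  case: g p {eq gS un Sp} => [[[a b] c] e] [[x y] z].
  by rewrite /place /vadd; congr (_, _, _); ring.
have [[r' er] [s' es]] := (place_surj 0 0 p r gS, place_surj 0 0 p s gS).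
have un' : uniq [:: (0, 0, 0); (1, 0, 0); r'; s'].
  by apply: (@map_uniq _ _ (place g 0 0 p)); rewrite !map_cons ep eq er es.
by apply: (classified_unit_step (tight_place 0 0 p T gS) _ _ _ _ un');
   rewrite /comp ?ep ?eq ?er ?es.
Qed.

(** A symmetry of T0 turns e1 into any of its vertices; for a step that is the negative of a vertex,
    [p] and [q] are exchanged first. *)
Lemma classified_level_pair S P p q r s : tight S P -> S p -> S q -> S r -> S s ->
  uniq [:: p; q; r; s] -> p.2 = q.2 -> classified S.
Proof.
case: p q => [[x y] z] [[x' y'] z'] T Sp Sq Sr Ss un /= ez; rewrite -ez in Sq un.
have un' : uniq [:: (x', y', z); (x, y, z); r; s].
  rewrite (perm_uniq (_ : perm_eq _ [:: (x, y, z); (x', y', z); r; s])) //.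
  by apply/permP=> c /=; lia.
have := flat_steps T Sp Sq; rewrite in_cons => /predU1P[[ex ey]|].
  move: un; rewrite /= inE (_ : (x, y, z) == (x', y', z)) //.
  by apply/eqP; congr (_, _, _); lia.
rewrite !inE => /or4P[|||/or3P[||]] /eqP[ex ey].
- apply: (classified_place_step (g := (1, 0, 0, 1)) T Sp Sq Sr Ss un) => //.
  by rewrite /place /vadd; congr (_, _, _); lia.
- apply: (classified_place_step (g := (0, 1, 1, 0)) T Sp Sq Sr Ss un) => //.
  by rewrite /place /vadd; congr (_, _, _); lia.
- apply: (classified_place_step (g := (-1, 1, -1, 0)) T Sp Sq Sr Ss un) => //.
  by rewrite /place /vadd; congr (_, _, _); lia.
- apply: (classified_place_step (g := (1, 0, 0, 1)) T Sq Sp Sr Ss un') => //.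
  by rewrite /place /vadd; congr (_, _, _); lia.
- apply: (classified_place_step (g := (0, 1, 1, 0)) T Sq Sp Sr Ss un') => //.
  by rewrite /place /vadd; congr (_, _, _); lia.
- apply: (classified_place_step (g := (-1, 1, -1, 0)) T Sq Sp Sr Ss un') => //.
  by rewrite /place /vadd; congr (_, _, _); lia.
Qed.

(** The heights fit in three consecutive integers, so two of the four points share a level. *)
Lemma tight_classified S P (s : seq vec) : tight S P -> uniq s -> size s = 4%N ->
  (forall p, p \in s -> S p) -> classified S.
Proof.
case: s => [|p1 [|p2 [|p3 [|p4 [|]]]]] // T un _ Sall.
have [S1 S2 S3 S4] : [/\ S p1, S p2, S p3 & S p4].
  by split; apply: Sall; rewrite !inE eqxx ?orbT.
have H p q r s : S p -> S q -> S r -> S s -> perm_eq [:: p1; p2; p3; p4] [:: p; q; r; s] ->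
    p.2 = q.2 -> classified S.
  move=> Sp Sq Sr Ss /perm_uniq un'.
  by apply: (classified_level_pair T) Sr Ss _ => //; rewrite -un'.
have pigeonhole (a b c d : Z) : b - a <= 2 -> a - b <= 2 -> c - a <= 2 -> a - c <= 2 ->
    d - a <= 2 -> a - d <= 2 -> c - b <= 2 -> b - c <= 2 -> d - b <= 2 -> b - d <= 2 ->
    d - c <= 2 -> c - d <= 2 ->
    a = b \/ a = c \/ a = d \/ b = c \/ b = d \/ c = d by lia.
have : p1.2 = p2.2 \/ p1.2 = p3.2 \/ p1.2 = p4.2 \/ p2.2 = p3.2 \/ p2.2 = p4.2 \/
    p3.2 = p4.2 by apply: pigeonhole; apply: (height_diff_le2 T).
case=> [|[|[|[|[|]]]]]; [
  apply: (H p1 p2 p3 p4) | apply: (H p1 p3 p2 p4) | apply: (H p1 p4 p2 p3) |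
  apply: (H p2 p3 p1 p4) | apply: (H p2 p4 p1 p3) | apply: (H p3 p4 p1 p2)] => //;
  by apply/permP=> c /=; lia.
Qed.

Lemma place_inverse g A B : g \in sym_T0 -> exists g' A' B', [/\ g' \in sym_T0,
  cancel (place g A B (0, 0, 0)) (place g' A' B' (0, 0, 0)) &
  cancel (place g' A' B' (0, 0, 0)) (place g A B (0, 0, 0))].
Proof.
(* If [h] inverts the planar part [g], the inverse map shears by minus the image of [(A, B)] under
   [h]. *)
pose shift (h : quad Z) : Z * Z :=
  let: (a, b, c, e) := h in (- (a * A + b * B), - (c * A + e * B)).
rewrite !inE => gS.
suff [h [hS c1 c2]] : exists h, [/\ h \in sym_T0,
    cancel (place g A B (0, 0, 0)) (place h (shift h).1 (shift h).2 (0, 0, 0)) &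
    cancel (place h (shift h).1 (shift h).2 (0, 0, 0)) (place g A B (0, 0, 0))].
  by exists h, (shift h).1, (shift h).2.
case/or4P: gS => [|||/or3P[||]] /eqP->; [exists (1, 0, 0, 1) | exists (1, -1, 0, -1) |
  exists (0, 1, 1, 0) | exists (-1, 1, -1, 0) | exists (0, -1, 1, -1) |
  exists (-1, 0, -1, 1)];
  by split=> // -[[x y] z]; rewrite /place /vadd /shift /fst /snd; congr (_, _, _); lia.
Qed.

End LatticeSets.

(** * Convexity and Minkowski sums *)

Import Order.TTheory GRing.Theory Num.Theory.
Local Open Scope ring_scope.

Section Convexity.
Variable R : realType.
Local Open Scope classical_set_scope.
Local Open Scope ring_scope.

(** Combinations of arbitrary length match the definition of [conv] directly. *)
Definition convex n (C : set 'cV[R]_n) : Prop :=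
  forall k (a : 'I_k -> R) (x : 'I_k -> 'cV[R]_n),
    (forall i, 0 <= a i) -> \sum_i a i = 1 -> (forall i, C (x i)) ->
    C (\sum_i a i *: x i).

Lemma convex2 n (C : set 'cV[R]_n) a b x y : convex C ->
  0 <= a -> 0 <= b -> a + b = 1 -> C x -> C y -> C (a *: x + b *: y).
Proof.
move=> cC a0 b0 ab Cx Cy.
have := @cC 2 (fun i => if i == ord0 then a else b) (fun i => if i == ord0 then x else y).
rewrite !big_ord_recl !big_ord0 /= !addr0; apply=> // i; by case: ifP.
Qed.

Lemma conv_convex n (s : seq 'cV[R]_n) : convex (conv s).
Proof.
move=> k a x a0 a1 sx.
have [b bP] := choice sx.
exists (fun j => \sum_i a i * b i j); split.
- by move=> j; apply: sumr_ge0 => i _; apply: mulr_ge0 => //; case: (bP i).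
- rewrite exchange_big /= -[RHS]a1; apply: eq_bigr => i _.
  by rewrite -mulr_sumr; case: (bP i) => _ -> _; rewrite mulr1.
- under eq_bigr => i _ do [case: (bP i) => _ _ ->; rewrite scaler_sumr].
  rewrite exchange_big /=; apply: eq_bigr => j _; rewrite scaler_suml.
  by apply: eq_bigr => i _; rewrite scalerA.
Qed.

Lemma conv_sub_convex n (s : seq 'cV[R]_n) (C : set 'cV[R]_n) : convex C ->
  (forall x, x \in s -> C x) -> conv s `<=` C.
Proof.
move=> cC sC _ [a [a0 a1 ->]]; apply: cC => // i.
by apply: sC; rewrite mem_nth.
Qed.

Lemma mem_conv n (s : seq 'cV[R]_n) x : x \in s -> conv s x.
Proof.
move=> xs; have ix : (index x s < size s)%N by rewrite index_mem.
exists (fun i => (i == Ordinal ix)%:R); split=> [i||]; first exact: ler0n.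
- by rewrite (bigD1 (Ordinal ix)) //= eqxx big1 ?addr0 // => i /negbTE ->.
- rewrite (bigD1 (Ordinal ix)) //= eqxx scale1r nth_index // big1 ?addr0 //.
  by move=> i /negbTE ->; rewrite scale0r.
Qed.

Lemma minkowski_add_convex n (A B : set 'cV[R]_n) :
  convex A -> convex B -> convex (minkowski_add A B).
Proof.
move=> cA cB k a x a0 a1 ABx.
have /choice[u uP] : forall i, exists y : 'cV[R]_n * 'cV[R]_n,
    [/\ A y.1, B y.2 & y.1 + y.2 = x i].
  by move=> i; have [y Ay [z Bz yz]] := ABx i; exists (y, z).
exists (\sum_i a i *: (u i).1); first by apply: cA => // i; case: (uP i).
exists (\sum_i a i *: (u i).2); first by apply: cB => // i; case: (uP i).
by rewrite -big_split /=; apply: eq_bigr => i _; rewrite -scalerDr; case: (uP i) => _ _ ->.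
Qed.

Lemma affine_preimage_convex m n (C : set 'cV[R]_n) (M : 'M[R]_(n, m)) t :
  convex C -> convex [set x | C (M *m x + t)].
Proof.
move=> cC k a x a0 a1 Cx /=.
have -> : M *m (\sum_i a i *: x i) + t = \sum_i a i *: (M *m x i + t).
  rewrite mulmx_sumr -[t in LHS]scale1r -a1 scaler_suml -big_split /=.
  by apply: eq_bigr => i _; rewrite scalerDr scalemxAr.
exact: cC.
Qed.

Lemma translate_preimage_convex n (C : set 'cV[R]_n) t :
  convex C -> convex [set x | C (x + t)].
Proof.
move=> /(@affine_preimage_convex n n _ 1%:M t).
by congr convex; apply/funext => x /=; rewrite mul1mx.
Qed.

Lemma lattice_convP n (s : seq 'cV[int]_n) (C : set 'cV[R]_n) : convex C ->
  (forall z, z \in s -> C (int_pt R z)) -> lattice_conv R s `<=` C.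
Proof.
by move=> cC sC; apply: conv_sub_convex => // _ /mapP[z zs ->]; apply: sC.
Qed.

Lemma mem_lattice_conv n (s : seq 'cV[int]_n) z : z \in s -> lattice_conv R s (int_pt R z).
Proof. by move=> zs; apply: mem_conv; apply: map_f. Qed.

Lemma int_ptD n (x y : 'cV[int]_n) : int_pt R (x + y) = int_pt R x + int_pt R y.
Proof. exact: map_mxD. Qed.

Lemma int_pt_mul n (M : 'M[int]_n) (x : 'cV[int]_n) :
  int_pt R (M *m x) = map_mx intr M *m int_pt R x.
Proof. exact: map_mxM. Qed.

Lemma segment_affine_dim n (x u : 'cV[int]_n) : u != 0 ->
  (0 < affine_dim (lattice_conv R [:: x; (x + u)%R]))%N.
Proof.
move=> u0; have n0 : (1 < n.+1)%N.
  by case: n x u u0 => [|n] // _ u /eqP[]; apply/matrixP=> -[].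
apply: leq_trans (@leq_bigmax_cond _ _ (fun k : 'I_n.+1 => k : nat) (Ordinal n0) _) => //=.
apply/asboolP; exists (int_pt R x), (int_pt R u); split.
- by apply: mem_lattice_conv; rewrite inE eqxx.
- move=> j; have -> : col j (int_pt R u) = int_pt R u.
    by apply/matrixP=> i l; rewrite !mxE !ord1.
  by rewrite -int_ptD; apply: mem_lattice_conv; rewrite !inE eqxx orbT.
- apply/eqP; rewrite eqn_leq rank_leq_col lt0n mxrank_eq0.
  by apply: contra u0 => /eqP uR; apply/eqP/matrixP=> i j;
     have /matrixP/(_ i j)/eqP := uR; rewrite !mxE intr_eq0 => /eqP.
Qed.

Lemma segment_lattice_polytope n (x u : 'cV[int]_n) :
  lattice_polytope (lattice_conv R [:: x; x + u]).
Proof. by exists [:: x; x + u]. Qed.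

(** With two summands fixed, convexity reduces the third to the ends of its segment; doing this for
    each summand leaves the eight corners. The base point [a] is absorbed into the first segment. *)
Lemma contains_zonotope n (C : set 'cV[R]_n) (a u v w : 'cV[int]_n) : convex C ->
  u != 0 -> v != 0 -> w != 0 ->
  (forall x, x \in [:: a; a + u; a + v; a + w; a + u + v; a + u + w; a + v + w;
                      a + u + v + w] -> C (int_pt R x)) ->
  contains_sum C 3.
Proof.
move=> cC u0 v0 w0 Ccorner.
pose F (i : 'I_3) := lattice_conv R
  (nth [::] [:: [:: a; a + u]; [:: 0; 0 + v]; [:: 0; 0 + w]] i).
exists F.
  move=> i; rewrite /F; case: i => [[|[|[|i]]] //= _];
    by split; [exact: segment_lattice_polytope | exact: segment_affine_dim].
rewrite /minkowski_sum !big_ord_recl big_ord0 => _ [x Fx [_ [y Fy [_ [z Fz [_ -> <-]]] <-]] <-].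
rewrite addr0 [x + _]addrC -/([set t | C (t + x)] (y + z)); rewrite /=.
have xC y' z' : C (int_pt R a + (y' + z')) -> C (int_pt R (a + u) + (y' + z')) ->
    C (x + (y' + z')).
  move=> C1 C2.
  apply: (lattice_convP (translate_preimage_convex (t := y' + z') cC) _ Fx) => t.
  by rewrite !inE => /orP[] /eqP ->.
rewrite addrC.
have yC x' z' : C (x' + z') -> C (x' + int_pt R v + z') -> C (x' + (y + z')).
  move=> C1 C2; rewrite addrCA.
  apply: (lattice_convP (translate_preimage_convex (t := x' + z') cC) _ Fy) => t.
  rewrite !inE add0r => /orP[] /eqP -> /=; first by rewrite /int_pt map_mx0 add0r.
  by rewrite addrA [_ + x']addrC.
have zC x' : C x' -> C (x' + int_pt R w) -> C (x' + z).
  move=> C1 C2; rewrite addrC.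
  apply: (lattice_convP (translate_preimage_convex (t := x') cC) _ Fz) => t.
  rewrite !inE add0r => /orP[] /eqP -> /=; first by rewrite /int_pt map_mx0 add0r.
  by rewrite addrC.
by apply: xC; apply: yC; apply: zC; rewrite -?int_ptD; apply: Ccorner; rewrite !inE eqxx ?orbT.
Qed.

End Convexity.

(** * Lattice points of a polytope as integer triples *)

Definition zpt (p : vec) : 'cV[int]_3 :=
  let: (x, y, z) := p in pt3 (int_of_Z x) (int_of_Z y) (int_of_Z z).

Definition Zpt (z : 'cV[int]_3) : vec :=
  (Z_of_int (z 0 0), Z_of_int (z 1 0), Z_of_int (z (inord 2) 0)).

Lemma col3P (K : Type) (z t : 'cV[K]_3) :
  z 0 0 = t 0 0 -> z 1 0 = t 1 0 -> z (inord 2) 0 = t (inord 2) 0 -> z = t.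
Proof.
move=> h0 h1 h2; apply/matrixP=> i j; rewrite (ord1 j) {j}.
case: i => [[|[|[|//]]] hi].
- by rewrite (_ : Ordinal hi = 0) //; apply: val_inj.
- by rewrite (_ : Ordinal hi = 1) //; apply: val_inj.
- by rewrite (_ : Ordinal hi = inord 2) //; apply: val_inj; rewrite /= inordK.
Qed.

Lemma pt3E x y z : [/\ pt3 x y z 0 0 = x, pt3 x y z 1 0 = y & pt3 x y z (inord 2) 0 = z].
Proof. by rewrite /pt3 !mxE inordK. Qed.

Lemma zptK : cancel zpt Zpt.
Proof.
case=> [[x y] z]; rewrite /zpt /Zpt.
by case: (pt3E (int_of_Z x) (int_of_Z y) (int_of_Z z)) => -> -> ->; rewrite !int_of_ZK.
Qed.

Lemma ZptK : cancel Zpt zpt.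
Proof.
move=> z; rewrite /zpt /Zpt !Z_of_intK.
by have [h0 h1 h2] := pt3E (z 0 0) (z 1 0) (z (inord 2) 0); apply: col3P.
Qed.

Lemma pt3D x y z x' y' z' : pt3 x y z + pt3 x' y' z' = pt3 (x + x') (y + y') (z + z').
Proof. by apply/matrixP=> i j; rewrite !mxE; case: i => [[|[|[|]]]]. Qed.

Lemma zptD p q : zpt (vadd p q) = zpt p + zpt q.
Proof. by case: p q => [[x y] z] [[x' y'] z']; rewrite /zpt /vadd pt3D !rmorphD. Qed.

Lemma zpt_eq0 u : nonzero u -> zpt u != 0.
Proof.
move=> u0; apply/eqP=> /(congr1 Zpt); rewrite zptK /Zpt !mxE => eu.
by move: u0; rewrite eu.
Qed.

Section Bridge.
Variable R : realType.

Definition rpt (x y z : R) : 'cV[R]_3 := \col_(i < 3) [:: x; y; z]`_i.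
Definition rZ (x : Z) : R := (int_of_Z x)%:~R.

Lemma rptD x y z x' y' z' : rpt x y z + rpt x' y' z' = rpt (x + x') (y + y') (z + z').
Proof. by apply/matrixP=> i j; rewrite !mxE; case: i => [[|[|[|]]]]. Qed.

Lemma rptZ a x y z : a *: rpt x y z = rpt (a * x) (a * y) (a * z).
Proof. by apply/matrixP=> i j; rewrite !mxE; case: i => [[|[|[|]]]]. Qed.

Lemma int_pt_pt3 (x y z : int) : int_pt R (pt3 x y z) = rpt x%:~R y%:~R z%:~R.
Proof. by apply/matrixP=> i j; rewrite !mxE; case: i => [[|[|[|]]]]. Qed.

Lemma int_pt_zpt (x y z : Z) : int_pt R (zpt (x, y, z)) = rpt (rZ x) (rZ y) (rZ z).
Proof. exact: int_pt_pt3. Qed.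

Lemma rZD x y : rZ (Z.add x y) = rZ x + rZ y. Proof. by rewrite /rZ !rmorphD. Qed.
Lemma rZM x y : rZ (Z.mul x y) = rZ x * rZ y. Proof. by rewrite /rZ !rmorphM. Qed.
Lemma rZB x y : rZ (Z.sub x y) = rZ x - rZ y. Proof. by rewrite /rZ !rmorphB. Qed.
Lemma rZ_le x y : Z.le x y -> rZ x <= rZ y.
Proof. by move=> xy; rewrite /rZ ler_int; lia. Qed.
Lemma rZ_lt x y : Z.lt x y -> rZ x < rZ y.
Proof. by move=> xy; rewrite /rZ ltr_int; lia. Qed.

(** The barycentric coordinates are one third of the slacks in the three edge inequalities. *)
Lemma mem_T0 x y : x + y <= 1 -> x - 2 * y <= 1 -> y - 2 * x <= 1 -> T0 R (rpt x y 0).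
Proof.
move=> h1 h2 h3; pose b := (1 - (y - 2 * x)) / 3; pose c := (1 - (x - 2 * y)) / 3.
pose e := (1 - (x + y)) / 3.
have -> : rpt x y 0 = \sum_(i < 3) [:: b; c; e]`_i *:
    [:: int_pt R (pt3 1 0 0); int_pt R (pt3 0 1 0); int_pt R (pt3 (-1) (-1) 0)]`_i.
  rewrite !big_ord_recl big_ord0 /= addr0 !int_pt_pt3 !rptZ !rptD /b /c /e.
  by congr rpt; rewrite ?rmorphN ?rmorph1 ?rmorph0; field.
apply: conv_convex.
- by move=> [[|[|[|]]]] //= _; rewrite /b /c /e divr_ge0 //; lra.
- by rewrite !big_ord_recl big_ord0 /= /b /c /e; field.
- by move=> [[|[|[|]]]] //= _; apply: mem_conv; rewrite !inE eqxx ?orbT.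
Qed.

Variable Q : set 'cV[R]_3.
Hypothesis Qpoly : lattice_polytope Q.

Lemma lattice_polytope_convex : convex Q.
Proof. by case: Qpoly => s _ ->; apply: conv_convex. Qed.

Let C := minkowski_add (T0 R) Q.

Lemma in_sum_mem p1 p2 p3 p4 mu x : Q (int_pt R (zpt p1)) -> Q (int_pt R (zpt p2)) ->
  Q (int_pt R (zpt p3)) -> Q (int_pt R (zpt p4)) -> in_sum (p1, p2, p3, p4) mu x ->
  C (int_pt R (zpt x)).
Proof.
case: p1 p2 p3 p4 x mu => [[x1 y1] z1] [[x2 y2] z2] [[x3 y3] z3] [[x4 y4] z4].
move=> [[x y] z] [[[a b] c] e] Q1 Q2 Q3 Q4; rewrite /in_sum /dilated_T0.
set d := Z.add _ e.
case/and5P=> /Z.leb_le/rZ_le a0 /Z.leb_le/rZ_le b0 /Z.leb_le/rZ_le c0 /Z.leb_le/rZ_le e0.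
case/and5P=> /Z.ltb_lt/rZ_lt d0 /Z.eqb_eq/(congr1 rZ) dz.
move=> /Z.leb_le/rZ_le h1 /Z.leb_le/rZ_le h2 /Z.leb_le/rZ_le h3.
have rZ0 : rZ 0 = 0 by []. have rZ2 : rZ 2 = 2 by [].
have dE : rZ d = rZ a + rZ b + rZ c + rZ e by rewrite /d !rZD.
rewrite rZ0 in a0 b0 c0 e0 d0.
rewrite !(rZD, rZB, rZM) ?rZ2 -?dE in dz h1 h2 h3.
have dn0 : rZ d != 0 by rewrite gt_eqF.
rewrite /C int_pt_zpt.
exists (rpt (rZ x - (rZ a * rZ x1 + rZ b * rZ x2 + rZ c * rZ x3 + rZ e * rZ x4) / rZ d)
            (rZ y - (rZ a * rZ y1 + rZ b * rZ y2 + rZ c * rZ y3 + rZ e * rZ y4) / rZ d) 0).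
  by apply: mem_T0; rewrite -(ler_pM2l d0) mulr1; [
    apply: le_trans h1 | apply: le_trans h2 | apply: le_trans h3];
    rewrite le_eqVlt; apply/orP; left; apply/eqP; field.
exists (\sum_(i < 4) [:: rZ a / rZ d; rZ b / rZ d; rZ c / rZ d; rZ e / rZ d]`_i *:
    [:: int_pt R (zpt (x1, y1, z1)); int_pt R (zpt (x2, y2, z2));
        int_pt R (zpt (x3, y3, z3)); int_pt R (zpt (x4, y4, z4))]`_i).
  apply: lattice_polytope_convex.
  - by move=> [[|[|[|[|]]]]] //= _; apply: divr_ge0; lra.
  - by rewrite !big_ord_recl big_ord0 /= addr0 -!mulrDl !addrA -dE divff.
  - by move=> [[|[|[|[|]]]]].
rewrite !big_ord_recl big_ord0 /= addr0 !int_pt_zpt !rptZ !rptD; congr rpt; first by field.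
  by field.
by rewrite add0r; apply: (mulfI dn0); rewrite dz; field.
Qed.

Lemma tight_lattice_points : minkowski_length C = 2%N ->
  tight (fun p => Q (int_pt R (zpt p))) (fun p => C (int_pt R (zpt p))).
Proof.
move=> C2.
have cC : convex C.
  exact: minkowski_add_convex (@conv_convex _ _ _) lattice_polytope_convex.
have C3 : ~ contains_sum C 3.
  (* The default value 0 of [xget] differs from 2, so 2 is a genuine maximum. *)
  move: C2; rewrite /minkowski_length; case: xgetP => [L -> [_ Lmax] L2 | //].
  by move/Lmax; rewrite L2.
have zonotope a u v w : nonzero u -> nonzero v -> nonzero w ->
    ~ (forall x, x \in corners a u v w -> C (int_pt R (zpt x))).
  move=> /zpt_eq0 u0 /zpt_eq0 v0 /zpt_eq0 w0 corn; apply: C3.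
  apply: (contains_zonotope (a := zpt a) cC u0 v0 w0) => x.
  by rewrite -!zptD -[[:: _; _; _; _; _; _; _; _]]/[seq zpt y | y <- corners a u v w] =>
    /mapP[y /corn Cy ->].
split=> // [p1 p2 p3 p4 mu x|a u u0 Ca Cu]; first exact: in_sum_mem.
(* A segment of lattice length 3 is a degenerate zonotope with three equal edges; its corners are
   convex combinations of its ends. *)
apply: (zonotope a u u u u0 u0 u0) => x.
have step (s t : R) : 0 <= s -> 0 <= t -> s + t = 1 ->
    C (int_pt R (zpt a) + (3 * t) *: int_pt R (zpt u)).
  move=> s0 t0 st; have := convex2 cC s0 t0 st Ca Cu.
  congr C; rewrite !zptD !int_ptD [t *: (_ + _)]scalerDr [s *: _ + _]addrA -scalerDl st.
  by rewrite scale1r mulrC -scalerA scaler_nat !mulrS mulr0n addr0.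
have [C0 C1 C2' C3'] : [/\ C (int_pt R (zpt a)), C (int_pt R (zpt a) + int_pt R (zpt u)),
    C (int_pt R (zpt a) + int_pt R (zpt u) + int_pt R (zpt u)) &
    C (int_pt R (zpt a) + int_pt R (zpt u) + int_pt R (zpt u) + int_pt R (zpt u))].
  split=> //.
  - have := @step (2 / 3) (1 / 3); rewrite (_ : 3 * (1 / 3) = 1) ?scale1r; last by field.
    by apply; lra.
  - have := @step (1 / 3) (2 / 3); rewrite (_ : 3 * (2 / 3) = 1 + 1)
      ?scalerDl ?scale1r ?addrA; last by field.
    by apply; lra.
  - by move: Cu; rewrite !zptD !int_ptD !addrA.
by rewrite /corners !inE => /or4P[|||/or4P[|||/orP[]]] /eqP->; rewrite ?zptD ?int_ptD.
Qed.

End Bridge.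

(** * Unimodular maps *)

Definition mx3 (rows : seq (seq int)) : 'M[int]_3 :=
  \matrix_(i < 3, j < 3) (nth [::] rows i)`_j.

Lemma mx3_pt3 a b c d e f g h k x y z :
  mx3 [:: [:: a; b; c]; [:: d; e; f]; [:: g; h; k]] *m pt3 x y z =
  pt3 (a * x + b * y + c * z) (d * x + e * y + f * z) (g * x + h * y + k * z).
Proof.
apply/matrixP=> i j; rewrite !mxE !big_ord_recl big_ord0 !mxE addr0 addrA.
by case: i => [[|[|[|]]]].
Qed.

Lemma mulmx_zpt_inj (M N : 'M[int]_3) : (forall p, M *m zpt p = N *m zpt p) -> M = N.
Proof.
move=> eqMN; apply/matrixP=> i j.
have := congr1 (fun z : 'cV_3 => z i 0) (eqMN (Zpt (delta_mx j 0))).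
by rewrite ZptK -!colE !mxE.
Qed.

Definition place_mx (g : quad Z) (A B : Z) : 'M[int]_3 :=
  let: (a, b, c, e) := g in
  mx3 [:: [:: int_of_Z a; int_of_Z b; int_of_Z A];
          [:: int_of_Z c; int_of_Z e; int_of_Z B]; [:: 0; 0; 1]].

Lemma zpt_place g A B o x : zpt (place g A B o x) = place_mx g A B *m zpt x + zpt o.
Proof.
case: g x o => [[[a b] c] e] [[x y] z] [[x' y'] z'].
rewrite addrC /place /vadd /zpt /place_mx mx3_pt3 pt3D.
by rewrite !mul0r mul1r !add0r !rmorphD !rmorphM.
Qed.

Lemma place_mx_inverse g A B : g \in sym_T0 -> exists g' A' B',
  [/\ g' \in sym_T0, place_mx g' A' B' *m place_mx g A B = 1%:M &
      place_mx g A B *m place_mx g' A' B' = 1%:M].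
Proof.
move=> /(place_inverse A B)[g' [A' [B' [g'S c1 c2]]]]; exists g', A', B'.
have zpt0 : zpt (Z0, Z0, Z0) = 0 by apply/matrixP=> i j; rewrite !mxE; case: i => [[|[|[|]]]].
have mxE' h C D p : place_mx h C D *m zpt p = zpt (place h C D (Z0, Z0, Z0) p).
  by rewrite zpt_place zpt0 addr0.
by split=> //; apply: mulmx_zpt_inj => p; rewrite -mulmxA !mxE' ?c1 ?c2 mul1mx.
Qed.

Definition T0_vertices : seq 'cV[int]_3 := [:: pt3 1 0 0; pt3 0 1 0; pt3 (-1) (-1) 0].

Lemma place_mx_T0 g A B z : g \in sym_T0 -> z \in T0_vertices ->
  place_mx g A B *m z \in T0_vertices.
Proof.
pose pt (t : int * int) := pt3 t.1 t.2 0.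
have -> : T0_vertices = [seq pt t | t <- [:: (1, 0); (0, 1); (-1, -1)]] by [].
move=> gS /mapP[[x y] xy ->]; move: g gS xy => [[[a b] c] e] gS xy.
rewrite /pt /place_mx mx3_pt3 !mulr0 !addr0 !mul0r !addr0.
apply: (map_f pt (x := (int_of_Z a * x + int_of_Z b * y, int_of_Z c * x + int_of_Z e * y))).
move: gS xy; rewrite !inE => /or4P[|||/or3P[||]] /eqP[-> -> -> ->];
  by case/or3P=> /eqP[-> ->].
Qed.

Section Transport.
Variable R : realType.

Lemma lattice_translate0 n (P : set 'cV[R]_n) : lattice_translate 0 P = P.
Proof.
apply/seteqP; split=> [_ [x Px <-]|x Px]; first by rewrite /int_pt map_mx0 addr0.
by exists x => //; rewrite /int_pt map_mx0 addr0.
Qed.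

Lemma unimodular_image_translate n (U : 'M[int]_n) b (P : set 'cV[R]_n) :
  unimodular_image U (lattice_translate b P) =
  lattice_translate (U *m b) (unimodular_image U P).
Proof.
apply/seteqP; split=> [_ [_ [x Px <-] <-]|_ [_ [x Px <-] <-]].
  by exists (map_mx intr U *m x); [exists x | rewrite int_pt_mul mulmxDr].
by exists (x + int_pt R b); [exists x | rewrite int_pt_mul mulmxDr].
Qed.

(** Both inclusions are checked on generators only, and the two generating lists need not correspond
    point by point. *)
Lemma unimodular_lattice_conv n (U V : 'M[int]_n) b (s s' : seq 'cV[int]_n) :
  V *m U = 1%:M -> U *m V = 1%:M ->
  (forall z, z \in s -> lattice_conv R s' (int_pt R (U *m z + b))) ->
  (forall z, z \in s' -> lattice_conv R s (int_pt R (V *m (z - b)))) ->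
  lattice_translate b (unimodular_image U (lattice_conv R s)) = lattice_conv R s'.
Proof.
move=> VU UV sub_s sub_s'; apply/seteqP; split.
  move=> _ [_ [x sx <-] <-].
  apply: (lattice_convP (affine_preimage_convex (M := map_mx intr U) (t := int_pt R b)
    (@conv_convex R n _)) _ sx) => z zs /=.
  by rewrite -int_pt_mul -int_ptD; apply: sub_s.
move=> y s'y; exists (y - int_pt R b); last by rewrite subrK.
exists (map_mx intr V *m (y - int_pt R b)); last first.
  by rewrite mulmxA -map_mxM UV map_mx1 mul1mx.
rewrite mulmxBr; apply: (lattice_convP (affine_preimage_convex (M := map_mx intr V)
  (t := - (map_mx intr V *m int_pt R b)) (@conv_convex R n _)) _ s'y) => z zs' /=.
rewrite -mulmxBr (_ : int_pt R z - int_pt R b = int_pt R (z - b)) -?int_pt_mul; last first.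
  by apply/matrixP=> i j; rewrite !mxE rmorphB.
exact: sub_s'.
Qed.

Lemma lattice_equiv_map (U V : 'M[int]_3) b (s s' : seq 'cV[int]_3) :
  V *m U = 1%:M -> U *m V = 1%:M -> s' = [seq U *m z + b | z <- s] ->
  lattice_equiv (lattice_conv R s) (lattice_conv R s').
Proof.
move=> VU UV ->; exists U, b; split; first by case/mulmx1_unit: VU.
apply: (unimodular_lattice_conv VU UV) => z.
  by move=> zs; apply: mem_lattice_conv; apply: map_f.
case/mapP=> t ts ->; rewrite addrK mulmxA VU mul1mx.
exact: mem_lattice_conv.
Qed.

(** Here, and for [Q2], the map sends the listed vertices to those of the target in the same
    order. *)
Lemma Q1_equiv_T0 : lattice_equiv (Q1 R) (T0 R).
Proof.
apply: (@lattice_equiv_map (mx3 [:: [:: -1; 0; -1]; [:: 0; 0; 1]; [:: 0; 1; 0]])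
  (mx3 [:: [:: -1; -1; 0]; [:: 0; 0; 1]; [:: 0; 1; 0]]) (pt3 1 0 0)).
- by apply: mulmx_zpt_inj => -[[x y] z]; rewrite -mulmxA !mx3_pt3 mul1mx; congr pt3; ring.
- by apply: mulmx_zpt_inj => -[[x y] z]; rewrite -mulmxA !mx3_pt3 mul1mx; congr pt3; ring.
- by rewrite /= !mx3_pt3 !pt3D.
Qed.

Lemma Q2_equiv_S2 : lattice_equiv (Q2 R) (S2 R).
Proof.
apply: (@lattice_equiv_map (mx3 [:: [:: -1; 0; -1]; [:: 1; 0; 0]; [:: 0; 1; 1]])
  (mx3 [:: [:: 0; 1; 0]; [:: 1; 1; 1]; [:: -1; -1; 0]]) (pt3 1 0 0)).
- by apply: mulmx_zpt_inj => -[[x y] z]; rewrite -mulmxA !mx3_pt3 mul1mx; congr pt3; ring.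
- by apply: mulmx_zpt_inj => -[[x y] z]; rewrite -mulmxA !mx3_pt3 mul1mx; congr pt3; ring.
- by rewrite /= !mx3_pt3 !pt3D.
Qed.

End Transport.

(** * Recovering the polytope from its lattice points *)

Lemma Zpt_pt3 x y z : Zpt (pt3 x y z) = (Z_of_int x, Z_of_int y, Z_of_int z).
Proof. by rewrite /Zpt; case: (pt3E x y z) => -> -> ->. Qed.

(** This is the one point of [model 3 0] that is not a listed vertex of [Q1]. *)
Lemma Q1_centroid (R : realType) : Q1 R (int_pt R (pt3 1 0 0)).
Proof.
have -> : int_pt R (pt3 1 0 0) = \sum_(i < 3) 3^-1 *:
    [:: int_pt R (pt3 0 0 0); int_pt R (pt3 0 0 1); int_pt R (pt3 3 0 (-1))]`_i.
  rewrite !big_ord_recl big_ord0 /= addr0 !int_pt_pt3 !rptZ !rptD.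
  by congr rpt; rewrite ?rmorphN ?rmorph1 ?rmorph0; field.
apply: conv_convex => [i||[[|[|[|]]]] //= _]; first by rewrite invr_ge0.
- by rewrite !big_ord_recl big_ord0 /=; field.
- by apply: mem_conv; rewrite !inE eqxx ?orbT.
- by apply: mem_conv; rewrite !inE eqxx ?orbT.
- by apply: mem_conv; rewrite !inE eqxx ?orbT.
Qed.

(** A lattice polytope is the hull of its lattice points: the unknown generators [s] are among them,
    hence correspond to points of the model. *)
Lemma unimodular_image_model (R : realType) s s' g g' A A' B B' o m n :
  place_mx g' A' B' *m place_mx g A B = 1%:M ->
  place_mx g A B *m place_mx g' A' B' = 1%:M ->
  (forall p, lattice_conv R s (int_pt R (zpt (place g A B o p))) <-> p \in model m n) ->
  (forall p, p \in model m n -> lattice_conv R s' (int_pt R (zpt p))) ->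
  (forall z, z \in s' -> Zpt z \in model m n) ->
  unimodular_image (place_mx g' A' B') (lattice_translate (- zpt o) (lattice_conv R s)) =
  lattice_conv R s'.
Proof.
move=> VU UV s_model model_s' s'_model; rewrite unimodular_image_translate.
have placeK p : place_mx g' A' B' *m zpt (place g A B o p) +
    place_mx g' A' B' *m (- zpt o) = zpt p.
  by rewrite -mulmxDr zpt_place addrK mulmxA VU mul1mx.
apply: (unimodular_lattice_conv UV VU) => z.
  move=> zs; have := mem_lattice_conv R zs; rewrite -[z]ZptK.
  have [p <-] : exists p, place g A B o p = Zpt z.
    exists (Zpt (place_mx g' A' B' *m (z - zpt o))); apply: (can_inj zptK).
    by rewrite zpt_place !ZptK mulmxA UV mul1mx subrK.
  by move/s_model/model_s'; rewrite placeK.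
move=> /s'_model/s_model; congr (lattice_conv R s (int_pt R _)).
by rewrite zpt_place mulmxBr !mulmxA UV !mul1mx opprK ZptK.
Qed.

Lemma lattice_card_seq (R : realType) (Q : set 'cV[R]_3) (s : seq 'cV[int]_3) : uniq s ->
  (forall z, Q (int_pt R z) <-> z \in s) -> lattice_card Q = size s.
Proof.
move=> us Qs; rewrite /lattice_card.
have -> : [set z | Q (int_pt R z)]%classic = [set` [fset z in s]%fset]%classic.
  by apply/seteqP; split=> z /=; rewrite inE => /Qs.
by rewrite set_fsetK card_fseq undup_id.
Qed.

Lemma lattice_card_geP (R : realType) (Q : set 'cV[R]_3) k : (k <= lattice_card Q)%N ->
  exists2 s : seq vec, uniq s /\ size s = k & forall p, p \in s -> Q (int_pt R (zpt p)).
Proof.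
rewrite /lattice_card; set F := fset_set _ => kF.
exists [seq Zpt z | z <- take k (enum_fset F)].
  split; last by rewrite size_map size_takel.
  by rewrite (map_inj_uniq (can_inj ZptK)) take_uniq ?fset_uniq.
move=> _ /mapP[z /mem_take zF ->]; rewrite ZptK.
(* In the infinite case [fset_set] is empty and has no member [z]. *)
move: zF; rewrite -/(z \in F) /F /fset_set; case: pselect => // Afin.
by case: cid => /= G eG zG; have : [set` G]%classic z by []; rewrite -eG.
Qed.

Theorem theorem3p9 (R : realType) (Q : set 'cV[R]_3) :
  lattice_polytope Q ->
  (4 <= lattice_card Q)%N ->
  minkowski_length (minkowski_add (T0 R) Q) = 2%N ->
  [/\ lattice_card Q = 4%N,
      exists (b : 'cV[int]_3) (U : 'M[int]_3),
        [/\ U \in unitmx,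
            unimodular_image U (T0 R) = T0 R &
            unimodular_image U (lattice_translate b Q) = Q1 R \/
            unimodular_image U (lattice_translate b Q) = Q2 R],
      lattice_equiv (Q1 R) (T0 R) &
      lattice_equiv (Q2 R) (S2 R)].
Proof.
move=> Qpoly /lattice_card_geP[l [ul sl] lQ] /(tight_lattice_points Qpoly) T.
have [g [A [B [o [m [n [gS mn QE]]]]]]] := tight_classified T ul sl lQ.
have [g' [A' [B' [g'S VU UV]]]] := place_mx_inverse A B gS.
have place_inj : injective (fun p => zpt (place g A B o p)).
  move=> p q; rewrite !zpt_place => /addIr/(congr1 (mulmx (place_mx g' A' B'))).
  by rewrite !mulmxA VU !mul1mx => /(can_inj zptK).
split; [| |exact: Q1_equiv_T0|exact: Q2_equiv_S2].
  rewrite (@lattice_card_seq _ _ [seq zpt (place g A B o p) | p <- model m n]) //.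
    by rewrite (map_inj_uniq place_inj); case: mn => -[-> ->].
  move=> z; split=> [Qz|/mapP[p /QE Qp ->] //].
  have [p ep] := place_surj A B o (Zpt z) gS.
  apply/mapP; exists p; last by rewrite ep ZptK.
  by apply/QE; rewrite ep ZptK.
(* Translating by [- zpt o] and then applying the inverse matrix undoes [place g A B o]. *)
exists (- zpt o), (place_mx g' A' B'); split; first by case/mulmx1_unit: VU.
  rewrite -[LHS]lattice_translate0; apply: (unimodular_lattice_conv UV VU) => z.
    by rewrite addr0 => /(place_mx_T0 A' B' g'S)/mem_lattice_conv.
  by rewrite subr0 => /(place_mx_T0 A B gS)/mem_lattice_conv.
case: Qpoly => s _ Qs; rewrite Qs in QE *.
case: mn => -[em en]; rewrite em en in QE; [left | right];
  apply: (unimodular_image_model VU UV QE).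
- move=> p; rewrite !inE => /or4P[] /eqP->; [|exact: Q1_centroid| |];
    by apply: mem_lattice_conv; rewrite !inE eqxx ?orbT.
- by move=> z; rewrite !inE => /or3P[] /eqP->; rewrite Zpt_pt3.
- by move=> p; rewrite !inE => /or4P[] /eqP->; apply: mem_lattice_conv; rewrite !inE eqxx ?orbT.
- by move=> z; rewrite !inE => /or4P[] /eqP->; rewrite Zpt_pt3.
Qed.
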